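(* Let $G$ be a connected $3K_1$-free graph. Then for every two distinct vertices $u,v\in V(G)$, $G$ has a path cover $\mathrm{PC}(u,v)$.
   Context: Graphs are finite, simple and undirected. A graph is $3K_1$-free if it contains no three pairwise non-adjacent vertices. A path cover $\mathrm{PC}(u,v)$ of $G$ is a pair of vertex-disjoint paths in $G$ which together contain all vertices of $G$, such that one path starts (has an end-vertex) at $u$ and the other path starts at $v$ (a path may consist of a single vertex). *)

(* Defs.v *)
From mathcomp Require Import all_boot.

Set Implicit Arguments.
Unset Strict Implicit.
Unset Printing Implicit Defensive.

(* A finite simple undirected graph is a symmetric irreflexive relation e on a
   finite type T of vertices. *)

Definition graph_connected (T : finType) (e : rel T) : Prop :=
  forall x y : T, connect e x y.

Definition three_K1_free (T : finType) (e : rel T) : Prop :=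
  forall x y z : T, x != y -> x != z -> y != z ->
    ~ [/\ ~~ e x y, ~~ e x z & ~~ e y z].

(* The two paths are u :: p and v :: q; uniqueness of the concatenation says
   both that each is a path without repeated vertices and that they are
   vertex-disjoint. *)
Definition path_cover (T : finType) (e : rel T) (u v : T) (p q : seq T) : Prop :=
  [/\ path e u p, path e v q, uniq ((u :: p) ++ (v :: q))
    & forall x : T, x \in (u :: p) ++ (v :: q)].

(* Main.v *)
Require Import Defs.
From mathcomp Require Import all_boot.

Set Implicit Arguments.
Unset Strict Implicit.
Unset Printing Implicit Defensive.

(** Take two disjoint paths from u and v covering as many vertices as possible,
    with ends a and b, and suppose a vertex x is missed.  Neither a nor b is
    adjacent to x, so a and b are adjacent and the two paths join into a single
    u-v path.  Cutting this path at any of its edges gives another pair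
    covering the same vertices, so no vertex on it has a neighbour outside it,
    contradicting connectedness. *)

Section PathCover.

Variables (T : finType) (e : rel T).
Hypothesis e_sym : symmetric e.

Definition disjoint_paths (u v : T) (p q : seq T) : bool :=
  [&& path e u p, path e v q & uniq ((u :: p) ++ (v :: q))].

Lemma disjoint_pathsC u v p q : disjoint_paths u v p q = disjoint_paths v u q p.
Proof. by rewrite /disjoint_paths uniq_catC andbCA. Qed.

Lemma disjoint_paths_rcons u v p q y :
  disjoint_paths u v p q -> y \notin (u :: p) ++ (v :: q) -> e (last u p) y ->
  disjoint_paths u v (rcons p y) q.
Proof.
case/and3P=> Pp Pq Upq ny epy; apply/and3P; split=> //.
  by rewrite rcons_path Pp.
rewrite -rcons_cons cat_rcons uniq_catC cat_cons cons_uniq uniq_catC Upq.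
by rewrite mem_cat orbC -mem_cat ny.
Qed.

Lemma path_rev_rcons u q a : path e u (rcons q a) = path e a (rev (u :: q)).
Proof.
have := rev_path e u (rcons q a); rewrite last_rcons belast_rcons => ->.
by apply: eq_path => x y; rewrite e_sym.
Qed.

Lemma disjoint_paths_join u v p q :
  disjoint_paths u v p q -> e (last u p) (last v q) ->
  path e u (p ++ rev (v :: q)) && uniq (u :: p ++ rev (v :: q)).
Proof.
case/and3P=> Pp Pq Upq epq.
rewrite cat_path Pp -path_rev_rcons rcons_path Pq e_sym epq -cat_cons.
by rewrite (perm_uniq (_ : perm_eq _ ((u :: p) ++ v :: q))) // perm_cat2l perm_rev.
Qed.

(** The edge leaving the last vertex of [u :: p] is dropped, and by symmetry the remaining tail is
    read backwards from [v]. *)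
Lemma disjoint_paths_cut u v p q :
  path e u (p ++ rcons q v) -> uniq (u :: p ++ rcons q v) ->
  disjoint_paths u v p (rev q).
Proof.
rewrite cat_path path_rev_rcons rev_cons rcons_path => /and3P[Pp Pq _] U.
rewrite /disjoint_paths Pp Pq -rev_rcons.
by rewrite (perm_uniq (_ : perm_eq _ ((u :: p) ++ rcons q v))) // perm_cat2l perm_rev.
Qed.

Hypothesis e_conn : graph_connected e.

(** A walk from [u] to [x] starts inside [s] and ends outside, so the induction finds the first step
    that leaves [s]. *)
Lemma connected_boundary (s : seq T) u x :
  u \in s -> x \notin s -> exists w y, [/\ w \in s, y \notin s & e w y].
Proof.
move=> us; have /connectP[r Pr ->] := e_conn u x.
elim: r u us Pr => [|y r IHr] u us /=; first by rewrite us.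
case/andP=> euy Pr; have [/IHr|ny] := boolP (y \in s); first exact.
by exists u, y.
Qed.

Hypothesis e_free : three_K1_free e.

(** Maximality is recast as growth by one vertex. The vertex gained is [x] if an end is adjacent to
    it, and otherwise some neighbour of the joined path, possibly not [x]. *)
Lemma disjoint_paths_extend u v p q x :
  disjoint_paths u v p q -> x \notin (u :: p) ++ (v :: q) ->
  exists p' q', disjoint_paths u v p' q' /\ size (p' ++ q') = (size (p ++ q)).+1.
Proof.
move=> D nx; have [eax|neax] := boolP (e (last u p) x).
  exists (rcons p x), q; split; first exact: disjoint_paths_rcons.
  by rewrite !size_cat size_rcons.
have [ebx|nebx] := boolP (e (last v q) x).
  exists p, (rcons q x); split; last by rewrite !size_cat size_rcons addnS.
  rewrite disjoint_pathsC disjoint_paths_rcons //; first by rewrite disjoint_pathsC.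
  by rewrite mem_cat orbC -mem_cat.
have eab : e (last u p) (last v q).
  apply/negPn/negP=> neab.
  have /and3P[_ _] := D; rewrite cat_uniq => /and3P[_ /hasPn dis _].
  move: nx; rewrite mem_cat => /norP[nxp nxq].
  apply: (@e_free (last u p) (last v q) x) => //.
  - by apply: contraNneq (dis _ (mem_last v q)) => <-; apply: mem_last.
  - by apply: contraNneq nxp => <-; apply: mem_last.
  - by apply: contraNneq nxq => <-; apply: mem_last.
have /andP[] := disjoint_paths_join D eab.
(* The extra unit is [v], a start omitted from [size (p ++ q)] but an interior or final entry of the
   joined path. *)
have szr : size (p ++ rev (v :: q)) = (size (p ++ q)).+1.
  by rewrite !size_cat size_rev addnS.
have lr : last u (p ++ rev (v :: q)) = v by rewrite last_cat rev_cons last_rcons.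
have mr : u :: p ++ rev (v :: q) =i (u :: p) ++ v :: q.
  by move=> z; rewrite -cat_cons !mem_cat mem_rev.
rewrite -mr in nx; move: szr lr nx {mr}; set r := p ++ _ => szr lr nx Pr Ur.
have [w [y [wr ny ewy]]] := connected_boundary (mem_head u r) nx.
move: wr Pr Ur szr lr ny {nx}; case/splitPl=> r1 r2 lw.
case/lastP: r2 => [|r2 z].
(* Here [w] is [v], and no edge follows it. The edge before [v] is cut instead, and the one-vertex
   path at [v] is extended by [y]. *)
- rewrite cats0; case/lastP: r1 lw => [|r1 z] //.
  rewrite !last_rcons => -> Pr Ur szr zv ny; subst w.
  rewrite -cats1 in Pr Ur.
  have D' := @disjoint_paths_cut u v r1 [::] Pr Ur.
  exists r1, [:: y]; split; last by rewrite -szr size_cat size_rcons addn1.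
  rewrite disjoint_pathsC (@disjoint_paths_rcons v u [::] r1 y) //.
  + by rewrite disjoint_pathsC.
  + by rewrite mem_cat orbC -mem_cat cats1.
(* Here the edge after [w] is cut, so the path from [u] ends at [w] and can be extended by [y]. *)
- move=> Pr Ur szr; rewrite last_cat last_rcons => zv ny; subst z.
  exists (rcons r1 y), (rev r2); split.
    apply: disjoint_paths_rcons; rewrite ?lw //; first exact: disjoint_paths_cut.
    by rewrite mem_cat -rev_rcons mem_rev -mem_cat.
  by rewrite -szr !size_cat !size_rcons size_rev addSnnS.
Qed.

End PathCover.

Theorem theorem3 (T : finType) (e : rel T)
    (e_sym : symmetric e) (e_irr : irreflexive e)
    (e_conn : graph_connected e) (e_free : three_K1_free e)
    (u v : T) (neq_uv : u != v) :
  exists p q : seq T, path_cover e u v p q.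
Proof.
suff grow n p q : #|T| - size (p ++ q) <= n -> disjoint_paths e u v p q ->
    exists p' q', path_cover e u v p' q'.
  by apply: (grow _ [::] [::] (leqnn _)); rewrite /disjoint_paths /= inE neq_uv.
elim: n p q => [|n IHn] p q szn D.
all: have [/forallP cov|/forallPn[x nx]] :=
  boolP [forall x, x \in (u :: p) ++ (v :: q)];
  first by case/and3P: D => *; exists p, q.
all: have [p' [q' [D' sz']]] := disjoint_paths_extend e_sym e_conn e_free D nx.
(* The extended pair has [size (p' ++ q') + 2] distinct vertices, the 2 being [u] and [v], so
   [size (p ++ q)] is below [#|T|] and the bound 0 is impossible. *)
- have /and3P[_ _ /card_uniqP cU] := D'.
  have := max_card (mem ((u :: p') ++ v :: q')).
  rewrite cU size_cat /= addnS addSn -size_cat sz' => /ltnW/ltnW lt_s.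
  by move: szn; rewrite leqn0 subn_eq0 leqNgt lt_s.
- by apply: (IHn p' q') => //; rewrite sz' subnS -subn1 leq_subLR add1n.
Qed.
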